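(* Let $G=(V,E,\mu,\omega)$ be a connected weighted graph with Laplacian $\Delta$, let $p\in V$, and let $T\in(0,\infty]$. Let $u$ be an ancient solution of the heat equation on $V\times[-T,0]$, i.e. $\partial_t u(x,t)=\Delta u(x,t)$ for all $(x,t)\in V\times[-T,0]$, satisfying $$|u(x,t)|\leq A_1e^{A_2\,d(x,p)\ln d(x,p)}\qquad\text{for all }(x,t)\in V\times[-T,0],$$ where $A_1,A_2$ are positive constants. Assume that for some constants $C>0$ and $A_3\geq 0$, $$\mathrm{Deg}(x)\leq C\,\max\{1,d(x,p)\}^{A_3}\qquad\text{for all }x\in V.$$ Suppose that $A_2+A_3\leq 1$. Then $u$ is analytic in $t\in[-T,0]$ with analytic radius $r>0$, where $r=+\infty$ if $A_2+A_3<1$, and $r\geq \frac{1}{2eC}$ if $A_2+A_3=1$. Moreover, for every $x\in V$ and every $t\in(-r,0]\cap[-T,0]$, $$u(x,t)=\sum_{k=0}^\infty a_k(x)\frac{t^k}{k!},$$ where the functions $a_k:V\to\mathbb R$ satisfy $\Delta a_k(x)=a_{k+1}(x)$ and $$|a_k(x)|\leq A_1(2C)^k e^{(A_2+A_3)\,(k+d(x,p))\ln(k+d(x,p))}\qquad\text{for all }x\in V,\ k=0,1,2,\dots$$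
   Context: A weighted graph $G=(V,E,\mu,\omega)$ consists of a locally finite, simple, undirected graph $(V,E)$, a vertex weight $\mu:V\to(0,\infty)$, $x\mapsto\mu_x$, and a symmetric edge weight $\omega:E\to(0,\infty)$, $\{x,y\}\mapsto\omega_{xy}=\omega_{yx}$, extended to $V\times V$ by $\omega_{xy}=0$ if $\{x,y\}\notin E$. Write $x\sim y$ if $\{x,y\}\in E$. For $f:V\to\mathbb R$, the Laplacian is $\Delta f(x)=\sum_{y\in V}\frac{\omega_{xy}}{\mu_x}(f(y)-f(x))$. The weighted degree is $\mathrm{Deg}(x)=\sum_{y\in V}\frac{\omega_{xy}}{\mu_x}$. The combinatorial distance is $d(x,y)=\inf\{n: x=z_0\sim z_1\sim\cdots\sim z_n=y\}$; the graph is connected, so $d$ is finite. Convention: $0\ln 0=0$. For $T=\infty$, $[-T,0]$ means $(-\infty,0]$. For functions $u:V\times[-T,0]\to\mathbb R$, $\Delta$ acts in the variable $x$, and time derivatives at endpoints of the time interval are one-sided. ''$u$ is analytic in $t\in[-T,0]$ with radius $r\in(0,\infty]$'' means: for every $x\in V$, $u(x,\cdot)$ is infinitely differentiable on $[-T,0]$, and for every $t_0\in[-T,0]$ and every $t\in[-T,0]$ with $|t-t_0|<r$ one has $u(x,t)=\sum_{k=0}^\infty \partial_t^k u(x,t_0)\frac{(t-t_0)^k}{k!}$, the series being convergent. *)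

(* Defs.v *)
From mathcomp Require Import all_boot all_order all_algebra.
From mathcomp Require Import all_classical all_reals all_analysis.

Set Implicit Arguments.
Unset Strict Implicit.
Unset Printing Implicit Defensive.

Import Order.TTheory GRing.Theory Num.Theory.
Import numFieldNormedType.Exports.

Local Open Scope classical_set_scope.
Local Open Scope ring_scope.

Record weighted_graph (R : realType) (V : choiceType) := WeightedGraph {
  adj : rel V;
  mu : V -> R;
  omega : V -> V -> R;
  adj_sym : symmetric adj;
  adj_irr : irreflexive adj;
  adj_locally_finite : forall x, finite_set [set y | adj x y];
  mu_gt0 : forall x, 0 < mu x;
  omega_sym : forall x y, omega x y = omega y x;
  omega_gt0 : forall x y, adj x y -> 0 < omega x y;
  omega_eq0 : forall x y, ~~ adj x y -> omega x y = 0 }.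

Section Graph.
Context {R : realType} {V : choiceType} (G : weighted_graph R V).

(* The sums over V are finitely supported, by [adj_locally_finite] and
   [omega_eq0]. *)
Definition laplacian (f : V -> R) (x : V) : R :=
  \sum_(y \in [set: V]) (omega G x y / mu G x * (f y - f x)).

Definition wdeg (x : V) : R :=
  \sum_(y \in [set: V]) (omega G x y / mu G x).

Definition walk (x y : V) (n : nat) : Prop :=
  exists s : seq V, [/\ size s = n, path (adj G) x s & last x s = y].

Definition connected_graph : Prop := forall x y : V, exists n, walk x y n.

(* The least length of a walk; the default value 0 is returned only if there
   is no walk, which does not happen in a connected graph. *)
Definition dist (x y : V) : nat :=
  xget 0%N [set n | walk x y n /\ forall m, walk x y m -> (n <= m)%N].

End Graph.

Section Time.
Context {R : realType}.

(* The interval [-T, 0]; it is ]-oo, 0] for T = +oo. *)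
Definition time_interval (T : \bar R) : set R :=
  [set t | (- T <= t%:E)%E /\ t <= 0].

Definition diff_quotient (f : R -> R) (t s : R) : R := (f s - f t) / (s - t).

(* Derivatives relative to D: only the points s of D, s <> t, are used, so that
   at an endpoint of an interval D the derivative is one-sided. *)
Definition is_derive_on (D : set R) (f : R -> R) (t l : R) : Prop :=
  diff_quotient f t s @[s --> within D t^'] --> l.

Definition derivable_on (D : set R) (f : R -> R) (t : R) : Prop :=
  cvg (diff_quotient f t s @[s --> within D t^']).

Definition derive_on (D : set R) (f : R -> R) (t : R) : R :=
  lim (diff_quotient f t s @[s --> within D t^']).

Definition deriven_on (D : set R) (k : nat) (f : R -> R) : R -> R :=
  iter k (derive_on D) f.

Definition smooth_on (D : set R) (f : R -> R) : Prop :=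
  forall k t, D t -> derivable_on D (deriven_on D k f) t.

Definition analytic_in_time {V : Type} (T : \bar R) (u : V -> R -> R)
    (r : \bar R) : Prop :=
  forall x : V,
    smooth_on (time_interval T) (u x) /\
    forall t0 t, time_interval T t0 -> time_interval T t ->
      (`|t - t0|%:E < r)%E ->
      series (fun k => deriven_on (time_interval T) k (u x) t0
                       * ((t - t0) ^+ k / k`!%:R)) @ \oo --> u x t.

Definition heat_solution {V : choiceType} (G : weighted_graph R V)
    (T : \bar R) (u : V -> R -> R) : Prop :=
  forall x t, time_interval T t ->
    is_derive_on (time_interval T) (u x) t (laplacian G (fun y => u y t) x).

End Time.

(* Main.v *)
Require Import Defs.
From mathcomp Require Import all_boot all_order all_algebra.
From mathcomp Require Import all_classical all_reals all_analysis.
From mathcomp Require Import finmap ring lra.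
Import Order.TTheory GRing.Theory Num.Theory.
Import numFieldNormedType.Exports.
Local Open Scope classical_set_scope.
Local Open Scope ring_scope.

(** By local finiteness the heat equation can be differentiated in time any
    number of times, so the k-th time derivative of u is the k-th iterate of
    the Laplacian, and |Delta f(x)| <= 2 Deg(x) max |f| over the unit ball
    around x.  Iterating, with n = d(x,p),
      |Delta^k u(x,t)| <= A1 (2C)^k exp (A2 (n+k) ln (n+k) + A3 k ln (n+k)),
    uniformly in t.  The factor k, rather than n+k, in front of A3 is what
    makes the induction on k close.  By Stirling-type bounds the Cauchy
    remainder of the Taylor expansion at t0 then tends to 0 if
    A2 + A3 < 1 or if 2 e C |t - t0| < 1. *)

(** * Derivatives relative to a set, and Taylor's formula with Cauchy remainder *)

Section RelativeDerivative.
Set Implicit Arguments.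
Unset Strict Implicit.
Context {R : realType}.
Implicit Types (D : set R) (f g : R -> R) (t l : R).

(** A second point b makes t a limit point of the interval D, so limits of difference quotients at t
    are unique, also when t is an endpoint. *)
Lemma within_dnbhs_proper D t b : is_interval D -> D t -> D b -> b != t ->
  ProperFilter (within D t^').
Proof.
move=> Dint Dt Db bt; apply: Build_ProperFilter => /= -[e /= e0 He].
have absE (x : R) : x != t -> `|t - x| < e -> ~ D x.
  by move=> xt tx Dx; exact: (He x tx xt Dx).
have [bltt|tltb|/eqP] := ltgtP b t; last by rewrite (negPf bt).
(* Whichever of b and t - e/2 is closer to t lies in D, being between b and t, and is within e of
   t. *)
- apply: (absE (Num.max b (t - e / 2))).
  + by rewrite lt_eqF // gt_max bltt /=; lra.
  + have : Num.max b (t - e / 2) < t by rewrite gt_max bltt /=; lra.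
    have : t - e / 2 <= Num.max b (t - e / 2) by rewrite le_max lexx orbT.
    by move=> ? ?; rewrite ger0_norm; lra.
  + apply: (Dint b t) => //; apply/andP; split; first by rewrite le_max lexx.
    by rewrite ge_max ltW //=; lra.
- apply: (absE (Num.min b (t + e / 2))).
  + by rewrite gt_eqF // lt_min tltb /=; lra.
  + have : t < Num.min b (t + e / 2) by rewrite lt_min tltb /=; lra.
    have : Num.min b (t + e / 2) <= t + e / 2 by rewrite ge_min lexx orbT.
    by move=> ? ?; rewrite ler0_norm; lra.
  + apply: (Dint t b) => //; apply/andP; split; last by rewrite ge_min lexx.
    by rewrite le_min ltW //=; lra.
Qed.

Lemma is_derive_on_ext D f g t l : D t -> (forall s, D s -> f s = g s) ->
  is_derive_on D g t l -> is_derive_on D f t l.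
Proof.
move=> Dt fg; apply: cvg_trans; apply: near_eq_cvg.
rewrite near_withinE; near=> s => Ds.
by rewrite /diff_quotient !fg.
Unshelve. all: by end_near. Qed.

Lemma derive_onE D f t l : ProperFilter (within D t^') ->
  is_derive_on D f t l -> derive_on D f t = l.
Proof. by move=> ? fl; apply: cvg_lim. Qed.

Lemma is_derive_on_continuous D f t l : is_derive_on D f t l ->
  f s @[s --> within D (nbhs t)] --> f t.
Proof.
move=> fl.
have f' : f s @[s --> within D t^'] --> f t.
  have : f t + diff_quotient f t s * (s - t) @[s --> within D t^'] -->
      f t + l * (t - t).
    apply: cvgD; first exact: cvg_cst.
    apply: cvgM => //; apply: cvgB; last exact: cvg_cst.
    by apply: cvg_within_filter; exact: nbhs_dnbhs.
  rewrite subrr mulr0 addr0; apply: cvg_trans; apply: near_eq_cvg.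
  rewrite near_withinE; near=> s => Ds.
  rewrite /diff_quotient divfK ?subrKC // subr_eq0.
  by near: s; exact: nbhs_dnbhs_neq.
(* The point s = t, missed by the punctured filter, is harmless because U contains f t. *)
move=> U Uft; change (nbhs t [set s | D s -> U (f s)]).
have f'U : nbhs t [set s | s != t -> D s -> U (f s)] := f' U Uft.
apply: filterS f'U => s /=; have [-> _ _|st] := eqVneq s t.
  exact: nbhs_singleton.
exact.
Unshelve. all: by end_near. Qed.

(** Near an interior point the restriction to D is vacuous, and Caratheodory's criterion applies to
    the slope function extended by l at t. This gives access to the mean value theorem. *)
Lemma is_derive_on_interior D f t l : D° t ->
  is_derive_on D f t l -> is_derive t 1 f l.
Proof.
move=> Dt fl; apply/is_derive1_caratheodory.
exists (fun s => if s == t then l else diff_quotient f t s); split.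
- move=> s; have [->|st] := eqVneq s t; first by rewrite !subrr mulr0.
  by rewrite /diff_quotient divfK // subr_eq0.
- apply/continuous_withinNx; rewrite eqxx.
  suff : diff_quotient f t s @[s --> t^'] --> l.
    apply: cvg_trans; apply: near_eq_cvg; near=> s.
    rewrite ifN //.
    by near: s; exact: nbhs_dnbhs_neq.
  apply: cvg_trans fl => U [e /= e0 He].
  have [e' /= e'0 He'] := Dt.
  exists (Num.min e e') => /=; first by rewrite lt_min e0.
  move=> s /=; rewrite lt_min => /andP[se se'] st.
  by apply: (He s se st); exact: He'.
- by rewrite eqxx.
Unshelve. all: by end_near. Qed.

Lemma is_derive_onB D f g t l m : is_derive_on D f t l ->
  is_derive_on D g t m -> is_derive_on D (fun s => f s - g s) t (l - m).
Proof.
move=> fl gm.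
have : diff_quotient f t s - diff_quotient g t s @[s --> within D t^'] -->
    l - m.
  exact: cvgB.
apply: cvg_trans; apply: near_eq_cvg; near=> s.
by rewrite /diff_quotient; ring.
Unshelve. all: by end_near. Qed.

Lemma is_derive_on_sum (I : Type) (r : seq I) (c : I -> R) (f : I -> R -> R)
    (l : I -> R) D t : (forall i, is_derive_on D (f i) t (l i)) ->
  is_derive_on D (fun s => \sum_(i <- r) c i * f i s) t
    (\sum_(i <- r) c i * l i).
Proof.
move=> fl.
have : \sum_(i <- r) c i * diff_quotient (f i) t s @[s --> within D t^'] -->
    \sum_(i <- r) c i * l i.
  apply: cvg_big => [|i _]; first exact: add_continuous.
  by apply: cvgM; [exact: cvg_cst|exact: fl].
apply: cvg_trans; apply: near_eq_cvg; near=> s.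
rewrite /diff_quotient -sumrB mulr_suml; apply: eq_bigr => i _.
by rewrite mulrA mulrBr.
Unshelve. all: by end_near. Qed.

(* The sum is the Taylor polynomial at t as a function of its base point s; its
   derivative telescopes. *)
Lemma taylor_sum_is_derive (F : nat -> R -> R) (n : nat) (s t : R) :
  (forall k, is_derive s 1 (F k) (F k.+1 s)) ->
  is_derive s 1 (fun s => \sum_(k < n.+1) F k s * ((t - s) ^+ k / k`!%:R))
    (F n.+1 s * ((t - s) ^+ n / n`!%:R)).
Proof.
move=> FD; elim: n => [|n IH].
  have -> : (fun s => \sum_(k < 1) F k s * ((t - s) ^+ k / k`!%:R)) = F 0%N.
    by apply/funext => z; rewrite big_ord1 expr0 fact0 divr1 mulr1.
  by apply: is_derive_eq; rewrite expr0 fact0 divr1 mulr1.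
have -> : (fun s => \sum_(k < n.+2) F k s * ((t - s) ^+ k / k`!%:R)) =
    (fun s => \sum_(k < n.+1) F k s * ((t - s) ^+ k / k`!%:R)) +
    (F n.+1 * (fun s => (t - s) ^+ n.+1 * (n.+1)`!%:R^-1)).
  by apply/funext => z; rewrite big_ord_recr.
have fact_neq0 m : m`!%:R != 0 :> R by rewrite pnatr_eq0 -lt0n fact_gt0.
have gD : is_derive s 1 (fun s => (t - s) ^+ n.+1 * (n.+1)`!%:R^-1)
    (- ((t - s) ^+ n / n`!%:R)).
  have -> : (fun s => (t - s) ^+ n.+1 * (n.+1)`!%:R^-1) =
      (n.+1)`!%:R^-1 *: (cst t - @id R) ^+ n.+1.
    by apply/funext => z; rewrite mulrC -[RHS]/(_ * _) exprfctE.
  apply: is_derive_eq.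
  rewrite /GRing.scale /= factS natrM /cst !fctE.
  by field; rewrite fact_neq0 nat1r pnatr_eq0.
apply: is_derive_eq (is_deriveD IH (is_deriveM (FD n.+1) gD)) _.
rewrite /GRing.scale /=.
by ring.
Qed.

(** The mean value theorem is applied in the base point of the Taylor polynomial, between t0 and t.
    It asks for derivatives in the interior and for continuity up to the ends, so one-sided
    derivatives at the ends of D suffice. *)
Lemma taylor_within D (F : nat -> R -> R) (M : R) (n : nat) (t0 t : R) :
  is_interval D -> (forall k s, D s -> is_derive_on D (F k) s (F k.+1 s)) ->
  (forall s, D s -> `|F n.+1 s| <= M) -> D t0 -> D t ->
  `|F 0%N t - \sum_(k < n.+1) F k t0 * ((t - t0) ^+ k / k`!%:R)| <=
    M * (`|t - t0| ^+ n.+1 / n`!%:R).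
Proof.
move=> Dint FD FM Dt0 Dt.
pose Phi s := \sum_(k < n.+1) F k s * ((t - s) ^+ k / k`!%:R).
have Phit : Phi t = F 0%N t.
  rewrite /Phi big_ord_recl subrr expr0 fact0 divr1 mulr1 big1 ?addr0 // => i _.
  by rewrite expr0n mul0r mulr0.
rewrite -[F 0%N t]Phit -/(Phi t0).
have mvt a b : a <= b -> D a -> D b -> exists2 c, a <= c <= b &
    Phi b - Phi a = F n.+1 c * ((t - c) ^+ n / n`!%:R) * (b - a).
  move=> ab Da Db.
  have Dab c : a <= c <= b -> D c by exact: Dint.
  suff [c cab ?] : exists2 c, c \in `[a, b] &
    Phi b - Phi a = F n.+1 c * ((t - c) ^+ n / n`!%:R) * (b - a) by exists c.
  apply: MVT_segment => // [c|].
    rewrite in_itv /= => /andP[ac cb].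
    apply: taylor_sum_is_derive => k; apply: (@is_derive_on_interior D).
      have cab : c \in `]a, b[ by rewrite in_itv /= ac.
      apply: filterS (near_in_itvoo cab) => s; rewrite in_itv /= => /andP[? ?].
      by apply: Dab; rewrite !ltW.
    by apply: FD; apply: Dab; rewrite (ltW ac) ltW.
  apply/subspace_continuousP => c /= cab.
  have Dc : D c by apply: Dab; move: cab; rewrite in_itv.
  have sub : within `[a, b] (nbhs c) `=>` within D (nbhs c).
    by apply: within_subset => s /=; rewrite in_itv; exact: Dab.
  apply: cvg_big => [|i _]; first exact: add_continuous.
  apply: cvgM; first by move=> U /(is_derive_on_continuous (FD i c Dc)) /sub.
  apply: cvgM; last exact: cvg_cst.
  apply: cvg_within_filter.
  apply: (@cvg_comp _ _ _ (fun s => t - s) (fun z => z ^+ i) _ (nbhs (t - c))).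
    by apply: cvgB; [exact: cvg_cst|exact: cvg_id].
  exact: exprn_continuous.
(* The intermediate point c is no farther from t than t0, so |t - c|^n is at most |t - t0|^n in the
   Cauchy remainder. *)
have key c : D c -> `|t - c| <= `|t - t0| ->
  `|F n.+1 c * ((t - c) ^+ n / n`!%:R) * (t - t0)| <=
    M * (`|t - t0| ^+ n.+1 / n`!%:R).
  move=> Dc ct; rewrite !normrM normfV normrX (ger0_norm (ler0n _ _)) exprSr.
  have M0 : 0 <= M by apply: le_trans (FM _ Dc).
  rewrite -!mulrA ler_pM ?mulr_ge0 ?exprn_ge0 ?invr_ge0 ?FM //.
  rewrite [n`!%:R^-1 * _]mulrC ler_wpM2r ?mulr_ge0 ?invr_ge0 //.
  by rewrite lerXn2r // ?nnegrE.
have [le|le] := leP t0 t.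
  have [c /andP[t0c ct] ->] := mvt _ _ le Dt0 Dt.
  apply: key; first by apply: (Dint _ _ Dt0 Dt); rewrite t0c.
  by rewrite !ger0_norm; lra.
have [c /andP[tc ct0] E] := mvt _ _ (ltW le) Dt Dt0.
rewrite distrC E -normrN -mulrN opprB.
apply: key; first by apply: (Dint _ _ Dt Dt0); rewrite tc.
by rewrite !ler0_norm; lra.
Qed.

End RelativeDerivative.

(** * Growth of m^m against n! *)

Section Asymptotics.
Context {R : realType}.
Set Implicit Arguments.
Unset Strict Implicit.

Lemma exp_coeff_le_expR (x : R) (n : nat) : 0 <= x ->
  x ^+ n / n`!%:R <= expR x.
Proof.
move=> x0; case: n => [|n].
  by rewrite expr0 fact0 divr1 -expR0 ler_expR.
by apply: le_trans (expR_ge1Dxn n x0); rewrite lerDr.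
Qed.

(* For m = n+1+d, the bounds m^(n+1) / n! <= m * expR m and
   m^(d+1) <= (d+1)! / e^(d+1) * expR (m * e) leave a geometric sequence; here
   e is an arbitrary positive number, not Euler's. *)
Lemma cvg_self_power_div_fact (K L e : R) (d : nat) :
  0 <= K -> 0 < e -> K * expR (1 - L + e) < 1 ->
  K ^+ n.+1 * ((n.+1 + d)%:R ^+ (n.+1 + d) * expR (- L * (n.+1 + d)%:R))
    / n`!%:R @[n --> \oo] --> 0.
Proof.
move=> K0 e0 K1.
pose rho := K * expR (1 - L + e).
have rho0 : 0 <= rho by rewrite mulr_ge0 ?expR_ge0.
(* The constant collects the bound for m^(d+1) and the d surplus factors [expR (1 - L + e)], as the
   exponent is m = n+1+d rather than n+1. *)
pose c := (d.+1)`!%:R / e ^+ d.+1 * expR (1 - L + e) ^+ d.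
have fact_neq0 m : m`!%:R != 0 :> R by rewrite pnatr_eq0 -lt0n fact_gt0.
apply: (@squeeze_cvgr _ _ _ _ (fun=> 0) (fun n => c * rho * rho ^+ n)).
- near=> n; apply/andP; split.
    by rewrite !mulr_ge0 ?exprn_ge0 ?expR_ge0 ?invr_ge0.
  set m := (n.+1 + d)%N.
  (* Replacing n! by (n+1)! costs a factor n+1 <= m, which later joins m^d to form m^(d+1). *)
  have mS : m%:R ^+ n.+1 / n`!%:R <= m%:R * expR m%:R :> R.
    have -> : n`!%:R^-1 = n.+1%:R / (n.+1)`!%:R :> R.
      rewrite factS natrM invfM mulrA mulfV ?mul1r // pnatr_eq0 //.
    rewrite mulrCA ler_pM ?divr_ge0 ?exprn_ge0 ?exp_coeff_le_expR //.
    by rewrite ler_nat leq_addr.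
  have md : m%:R ^+ d.+1 <= (d.+1)`!%:R / e ^+ d.+1 * expR (m%:R * e).
    have := @exp_coeff_le_expR (m%:R * e) d.+1.
    rewrite mulr_ge0 ?(ltW e0) // => /(_ isT).
    rewrite ler_pdivrMr ?ltr0n ?fact_gt0 // exprMn => H.
    by rewrite mulrAC ler_pdivlMr ?exprn_gt0 // [leRHS]mulrC.
  have -> : m%:R ^+ m = m%:R ^+ n.+1 * m%:R ^+ d :> R by rewrite -exprD.
  have -> : c * rho * rho ^+ n = K ^+ n.+1 * ((d.+1)`!%:R / e ^+ d.+1 *
      expR (m%:R * e) * expR m%:R * expR (- L * m%:R)).
    rewrite -mulrA -exprS exprMn /c.
    have : expR (m%:R * e) * expR m%:R * expR (- L * m%:R) =
        expR (1 - L + e) ^+ d * expR (1 - L + e) ^+ n.+1.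
      rewrite -!expRD -exprD -expRM_natl addnC; congr expR.
      by rewrite -/m; ring.
    move=> E; transitivity (K ^+ n.+1 * ((d.+1)`!%:R / e ^+ d.+1 *
      (expR (m%:R * e) * expR m%:R * expR (- L * m%:R)))); last by ring.
    by rewrite E; ring.
  rewrite -mulrA ler_wpM2l ?exprn_ge0 //.
  have -> : m%:R ^+ n.+1 * m%:R ^+ d * expR (- L * m%:R) / n`!%:R =
    m%:R ^+ n.+1 / n`!%:R * m%:R ^+ d * expR (- L * m%:R) by ring.
  rewrite ler_wpM2r ?expR_ge0 //.
  apply: (@le_trans _ _ (m%:R * expR m%:R * m%:R ^+ d)).
    by rewrite ler_wpM2r ?exprn_ge0.
  rewrite mulrAC -exprS ler_wpM2r ?expR_ge0 //.
- exact: cvg_cst.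
- by apply: cvg_geometric; rewrite ger0_norm.
Unshelve. all: by end_near. Qed.

Lemma expR_natMln (m : nat) : (0 < m)%N ->
  expR (m%:R * ln m%:R) = m%:R ^+ m :> R.
Proof. by move=> m0; rewrite expRM_natl lnK // posrE ltr0n. Qed.

(** With m = n+1+d, m^(Am) equals m^m times the exponential of -(1-A) m ln m. Once (1-A) ln m is at
    least a suitable L, [cvg_self_power_div_fact] dominates the sequence. *)
Lemma cvg_taylor_bound (A K c : R) (d : nat) :
  A <= 1 -> 0 <= K -> (A = 1 -> K * expR 1 < 1) ->
  c * K ^+ n.+1 * expR (A * ((n.+1 + d)%:R * ln (n.+1 + d)%:R)) / n`!%:R
    @[n --> \oo] --> 0.
Proof.
move=> A1 K0 KA.
suff [L [e [e0 Ke AL]]] : exists L e, [/\ 0 < e, K * expR (1 - L + e) < 1 &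
    \forall n \near \oo, (1 - A) * ln (n.+1 + d)%:R >= L].
  have H : `|c| * (K ^+ n.+1 * ((n.+1 + d)%:R ^+ (n.+1 + d) *
      expR (- L * (n.+1 + d)%:R)) / n`!%:R) @[n --> \oo] --> `|c| * 0.
    by apply: cvgM; [exact: cvg_cst|exact: cvg_self_power_div_fact e0 Ke].
  rewrite mulr0 in H.
  apply/norm_cvg0P.
  apply: squeeze_cvgr (cvg_cst 0) H.
  near=> n; rewrite normr_ge0 /=.
  have Lln : L <= (1 - A) * ln (n.+1 + d)%:R by near: n.
  set m := (n.+1 + d)%N in Lln *.
  rewrite !normrM (ger0_norm (expR_ge0 _)) normfV normr_nat normrX.
  rewrite (ger0_norm K0).
  rewrite -!mulrA ler_wpM2l // ler_wpM2l ?exprn_ge0 // !mulrA.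
  rewrite ler_wpM2r ?invr_ge0 // -expR_natMln // -expRD ler_expR.
  by move: Lln => /(ler_wpM2r (ler0n R m)); lra.
(* For A = 1 take L = 0; for A < 1 any L will do as ln m tends to +oo. *)
have [A_1|An1] := eqVneq A 1.
  (* Half of the gap below 1 works as e, since K * expR 1 < 1 - e <= expR (- e). *)
  exists 0, ((1 - K * expR 1) / 2); have {}KA := KA A_1; split; first by lra.
    set e := _ / 2; have e1 : K * expR 1 < 1 - e by rewrite /e; lra.
    rewrite subr0 expRD mulrA.
    have := expR_ge1Dx (- e); rewrite expRN => H.
    rewrite -ltr_pdivlMr ?expR_gt0 // mul1r; apply: lt_le_trans H; lra.
  by near=> n; rewrite A_1 subrr mul0r.
have {}A1 : A < 1 by rewrite lt_neqAle An1.
(* These values make the exponent -K, and K < 1 + K <= expR K. *)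
exists (K + 2), 1; split=> //.
  have -> : 1 - (K + 2) + 1 = - K by ring.
  rewrite expRN ltr_pdivrMr ?expR_gt0 // mul1r.
  by apply: lt_le_trans (expR_ge1Dx _); lra.
near=> n.
rewrite mulrC -ler_pdivrMr ?subr_gt0 //.
rewrite -[leLHS]expRK ler_ln ?posrE ?expR_gt0 ?ltr0n //.
apply: (@le_trans _ _ n%:R).
  by near: n; exact: nbhs_infty_ger.
by rewrite ler_nat (leq_trans (leqnSn n)) ?leq_addr.
Unshelve. all: by end_near. Qed.

End Asymptotics.

(** * Distance, Laplacian and growth of its iterates *)

Section Graph.
Context {R : realType} {V : choiceType} (G : weighted_graph R V).
Set Implicit Arguments.
Unset Strict Implicit.

(** A shortest walk exists by strong induction on the length, which excludes the default value of
    [xget]. *)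
Lemma dist_walk x y : connected_graph G -> walk G x y (dist G x y).
Proof.
move=> Gc; rewrite /dist; case: xgetP => [n _ []//|nomin].
have [n] := Gc x y; elim/ltn_ind: n => n IH xyn.
have [[m xym mn]|H] := pselect (exists2 m, walk G x y m & (m < n)%N).
  exact: IH xym.
exfalso; apply: (nomin n); split=> // m xym.
by rewrite leqNgt; apply/negP => mn; apply: H; exists m.
Qed.

Lemma dist_le_walk x y n : walk G x y n -> (dist G x y <= n)%N.
Proof.
rewrite /dist; case: xgetP => [m _ [_]|//]; exact.
Qed.

Lemma dist_adj p x y : connected_graph G -> adj G x y ->
  (dist G y p <= (dist G x p).+1)%N.
Proof.
move=> Gc xy; apply: dist_le_walk.
have [s [ss ps ls]] := @dist_walk x p Gc.
by exists (x :: s); split; rewrite /= ?ss // adj_sym xy.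
Qed.

(** A finite set containing the support of the weights at x, over which the sums over V become
    ordinary big sums. *)
Definition neighbors x : {fset V} := fset_set [set y | adj G x y].

Lemma mem_neighbors x y : (y \in neighbors x) = adj G x y.
Proof.
rewrite in_fset_set; last exact: adj_locally_finite.
by apply/idP/idP => [/set_mem|xy]; last exact/mem_set.
Qed.

Lemma laplacianE f x : laplacian G f x =
  \sum_(y <- neighbors x) omega G x y / mu G x * (f y - f x).
Proof.
apply: fsbigTE => y; rewrite mem_neighbors => xy.
by rewrite omega_eq0 // !mul0r.
Qed.

Lemma wdegE x : wdeg G x = \sum_(y <- neighbors x) omega G x y / mu G x.
Proof.
by apply: fsbigTE => y; rewrite mem_neighbors => xy; rewrite omega_eq0 // mul0r.
Qed.

Lemma laplacian_le f x M : `|f x| <= M ->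
  (forall y, adj G x y -> `|f y| <= M) ->
  `|laplacian G f x| <= wdeg G x * (2 * M).
Proof.
move=> fxM fM; rewrite laplacianE wdegE mulr_suml.
apply: le_trans (ler_norm_sum _ _ _) _.
rewrite big_seq [leRHS]big_seq; apply: ler_sum => y.
rewrite mem_neighbors => xy.
have w0 : 0 <= omega G x y / mu G x.
  by rewrite divr_ge0 // ltW ?omega_gt0 ?mu_gt0.
rewrite normrM ger0_norm // ler_wpM2l //.
by apply: le_trans (ler_normB _ _) _; have := fM y xy; lra.
Qed.

Lemma is_derive_on_laplacian (D : set R) (f : V -> R -> R) (df : V -> R) t x :
  (forall y, is_derive_on D (f y) t (df y)) ->
  is_derive_on D (fun s => laplacian G (fun y => f y s) x) t (laplacian G df x).
Proof.
move=> fD; rewrite laplacianE.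
have -> : (fun s => laplacian G (fun y => f y s) x) = (fun s =>
    \sum_(y <- neighbors x) omega G x y / mu G x * (f y s - f x s)).
  by apply/funext => s; rewrite laplacianE.
by apply: is_derive_on_sum => y; apply: is_derive_onB.
Qed.

Lemma is_derive_on_iter_laplacian (T : \bar R) (u : V -> R -> R) k x t :
  heat_solution G T u -> time_interval T t ->
  is_derive_on (time_interval T) (fun s => iter k (laplacian G) (u ^~ s) x) t
    (iter k.+1 (laplacian G) (u ^~ t) x).
Proof.
move=> u_heat Tt; elim: k x => [|k IH] x; first exact: u_heat.
exact: (is_derive_on_laplacian
  (f := fun y s => iter k (laplacian G) (u ^~ s) y)).
Qed.

(** The case n = 0 holds because [ln] is 0 at 0, in accordance with the convention 0 ln 0 = 0. *)
Lemma ln_nat_ge0 (n : nat) : 0 <= ln n%:R :> R.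
Proof. by case: n => [|n]; [rewrite ln0|rewrite ln_ge0 // ler1n]. Qed.

Lemma ler_ln_nat (m n : nat) : (m <= n)%N -> ln m%:R <= ln n%:R :> R.
Proof.
case: m => [_|m mn]; first by rewrite ln0 // ln_nat_ge0.
by rewrite ler_ln ?posrE ?ltr0n ?ler_nat // (leq_trans _ mn).
Qed.

Lemma iter_laplacian_le (p : V) (A1 A2 A3 C : R) (f : V -> R) k x :
  connected_graph G -> 0 <= A1 -> 0 <= A2 -> 0 <= A3 -> 0 <= C ->
  (forall x, wdeg G x <= C * (Num.max 1 (dist G x p)%:R `^ A3)) ->
  (forall x,
    `|f x| <= A1 * expR (A2 * ((dist G x p)%:R * ln (dist G x p)%:R))) ->
  `|iter k (laplacian G) f x| <= A1 * (2 * C) ^+ k *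
    expR (A2 * ((k + dist G x p)%:R * ln (k + dist G x p)%:R) +
          A3 * (k%:R * ln (k + dist G x p)%:R)).
Proof.
move=> Gc A10 A20 A30 C0 degC fA; elim: k x => [|k IH] x.
  by rewrite expr0 mulr1 mul0r mulr0 addr0.
set m := (k.+1 + dist G x p)%N.
(* A common bound on the unit ball around x: each y in it has k + d(y,p) <= m. *)
pose M := A1 * (2 * C) ^+ k *
  expR (A2 * (m%:R * ln m%:R) + A3 * (k%:R * ln m%:R)).
have IHM y : (dist G y p <= (dist G x p).+1)%N ->
    `|iter k (laplacian G) f y| <= M.
  move=> yx; apply: le_trans (IH y) _.
  have ym : (k + dist G y p <= m)%N by rewrite /m addSnnS leq_add2l.
  rewrite ler_wpM2l ?mulr_ge0 ?exprn_ge0 ?mulr_ge0 //.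
  rewrite ler_expR lerD // ler_wpM2l // ler_pM ?ln_nat_ge0 ?ler_ln_nat //.
  by rewrite ler_nat.
apply: le_trans (laplacian_le (IHM x (leqnSn _)) _) _ => [y xy|].
  by apply: IHM; exact: dist_adj.
have M0 : 0 <= 2 * M by rewrite !mulr_ge0 ?exprn_ge0 ?expR_ge0 ?mulr_ge0.
apply: le_trans (ler_wpM2r M0 (degC x)) _.
(* Since m >= max(1, d(x,p)), the degree contributes one more A3 ln m, which turns the factor k into
   k+1. *)
have powm : Num.max 1 (dist G x p)%:R `^ A3 <= expR (A3 * ln m%:R).
  rewrite /powR ifF; last by rewrite gt_eqF // lt_max ltr01.
  rewrite ler_expR ler_wpM2l // ler_ln ?posrE ?lt_max ?ltr01 ?ltr0n ?addSn //.
  by rewrite ge_max ler1n ler_nat /m leq_addl addSn.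
apply: le_trans (ler_wpM2r M0 (ler_wpM2l C0 powm)) _.
have -> : A2 * (m%:R * ln m%:R) + A3 * (k.+1%:R * ln m%:R) =
    A2 * (m%:R * ln m%:R) + A3 * (k%:R * ln m%:R) + A3 * ln m%:R.
  by rewrite -natr1; ring.
rewrite [in leRHS]expRD exprS le_eqVlt; apply/orP; left; apply/eqP.
by rewrite /M; ring.
Qed.

End Graph.

(** * Time derivatives of the solution and convergence of its Taylor series *)

Section Main.
Context {R : realType}.
Set Implicit Arguments.
Unset Strict Implicit.

Lemma cvg_taylor_series (D : set R) (F : nat -> R -> R) (A K c : R) (d : nat)
    (t0 t : R) :
  is_interval D -> (forall k s, D s -> is_derive_on D (F k) s (F k.+1 s)) ->
  (forall k s, D s ->
    `|F k s| <= c * K ^+ k * expR (A * ((k + d)%:R * ln (k + d)%:R))) ->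
  A <= 1 -> 0 <= K -> (A = 1 -> K * `|t - t0| * expR 1 < 1) ->
  D t0 -> D t ->
  series (fun k => F k t0 * ((t - t0) ^+ k / k`!%:R)) @ \oo --> F 0%N t.
Proof.
move=> Dint FD FM A1 K0 KA Dt0 Dt.
(* The Taylor estimate of order n has n+1 terms, hence the shift. Its right-hand side is the null
   sequence of [cvg_taylor_bound] with K times |t - t0| in place of K. *)
rewrite -cvg_shiftS; apply/subr_cvg0/norm_cvg0P.
have bnd0 := @cvg_taylor_bound R A (K * `|t - t0|) c d A1
  (mulr_ge0 K0 (normr_ge0 _)) KA.
apply: squeeze_cvgr (cvg_cst 0) bnd0; near=> n.
rewrite normr_ge0 /= distrC /series /= big_mkord.
apply: le_trans (taylor_within Dint FD (FM n.+1) Dt0 Dt) _.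
by rewrite exprMn le_eqVlt; apply/orP; left; apply/eqP; ring.
Unshelve. all: by end_near. Qed.

Lemma time_interval_is_interval (T : \bar R) : is_interval (time_interval T).
Proof.
move=> x y [Tx _] [_ y0] z /andP[xz zy]; split; last exact: le_trans y0.
by apply: le_trans Tx _; rewrite lee_fin.
Qed.

Lemma time_interval_neq (T : \bar R) (t : R) : (0 < T)%E -> time_interval T t ->
  exists2 b, time_interval T b & b != t.
Proof.
move=> T0 Tt; have [->|t0] := eqVneq t 0; last first.
  exists 0; last by rewrite eq_sym.
  by split; rewrite // leeNl oppe0 ltW.
case: T T0 {Tt} => [T||] //.
- rewrite lte_fin => T0; exists (- T); last by rewrite oppr_eq0 gt_eqF.
  by split; [rewrite EFinN|rewrite oppr_le0 ltW].
- exists (-1); rewrite ?oppr_eq0 ?oner_eq0 //.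
  by split; [rewrite leNye|rewrite lerN10].
Qed.

Lemma within_time_interval_proper (T : \bar R) (t : R) : (0 < T)%E ->
  time_interval T t -> ProperFilter (within (time_interval T) t^').
Proof.
move=> T0 Tt; have [b Tb bt] := time_interval_neq T0 Tt.
exact: within_dnbhs_proper (@time_interval_is_interval T) Tt Tb bt.
Qed.

(** The induction hypothesis gives equality on the interval only, and this is enough because
    relative difference quotients see no other points. *)
Lemma deriven_on_heat (V : choiceType) (G : weighted_graph R V) (T : \bar R)
    (u : V -> R -> R) k x t :
  (0 < T)%E -> heat_solution G T u -> time_interval T t ->
  deriven_on (time_interval T) k (u x) t = iter k (laplacian G) (u ^~ t) x.
Proof.
move=> T0 u_heat; elim: k t => [//|k IH] t Tt.
apply: derive_onE; first exact: within_time_interval_proper.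
exact: is_derive_on_ext Tt IH (is_derive_on_iter_laplacian u_heat Tt).
Qed.

End Main.

Theorem theorem1p2 (R : realType) (V : choiceType) (G : weighted_graph R V)
  (G_connected : connected_graph G) (p : V)
  (T : \bar R) (T_gt0 : (0 < T)%E)
  (u : V -> R -> R) (u_heat : heat_solution G T u)
  (A1 A2 : R) (A1_gt0 : 0 < A1) (A2_gt0 : 0 < A2)
  (u_growth : forall (x : V) (t : R), time_interval T t ->
     `|u x t| <= A1 * expR (A2 * ((dist G x p)%:R * ln (dist G x p)%:R)))
  (C A3 : R) (C_gt0 : 0 < C) (A3_ge0 : 0 <= A3)
  (deg_growth : forall x : V,
     wdeg G x <= C * (Num.max 1 (dist G x p)%:R `^ A3))
  (A23_le1 : A2 + A3 <= 1) :
  exists r : \bar R,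
    [/\ (0 < r)%E,
        analytic_in_time T u r,
        A2 + A3 < 1 -> r = +oo%E,
        A2 + A3 = 1 -> ((1 / (2 * expR 1 * C))%:E <= r)%E
      & exists a : nat -> V -> R,
          [/\ forall (x : V) (t : R), (- r < t%:E)%E -> time_interval T t ->
                series (fun k => a k x * (t ^+ k / k`!%:R)) @ \oo --> u x t,
              forall (k : nat) (x : V), laplacian G (a k) x = a k.+1 x
            & forall (k : nat) (x : V),
                `|a k x| <= A1 * (2 * C) ^+ k *
                  expR ((A2 + A3) * ((k + dist G x p)%:R *
                                     ln (k + dist G x p)%:R))]].
Proof.
set A := A2 + A3 in A23_le1 *; set D := time_interval T in u_growth *.
pose F x k t := iter k (laplacian G) (u ^~ t) x.
have F_le x k t : D t -> `|F x k t| <= A1 * (2 * C) ^+ k *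
    expR (A * ((k + dist G x p)%:R * ln (k + dist G x p)%:R)).
  move=> Dt; have ut y := u_growth y t Dt.
  apply: le_trans (iter_laplacian_le k x G_connected (ltW A1_gt0) (ltW A2_gt0)
    A3_ge0 (ltW C_gt0) deg_growth ut) _.
  rewrite ler_wpM2l ?mulr_ge0 ?exprn_ge0 ?mulr_ge0 //
    ?(ltW A1_gt0) ?(ltW C_gt0) //.
  (* The factor k in front of A3 is relaxed to k + d(x,p) only now, merging A2 and A3 into A. *)
  rewrite ler_expR mulrDl lerD2l ler_wpM2l // ler_wpM2r ?ln_nat_ge0 //.
  by rewrite ler_nat leq_addr.
(* For A = 1 the Taylor bound needs 2C |t - t0| e < 1, with Euler's e, which is exactly |t - t0| <
   1/(2eC). *)
pose r : \bar R := if A == 1 then (1 / (2 * expR 1 * C))%:E else +oo%E.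
have taylor x t0 t : D t0 -> D t -> (`|t - t0|%:E < r)%E ->
    series (fun k => F x k t0 * ((t - t0) ^+ k / k`!%:R)) @ \oo --> u x t.
  move=> Dt0 Dt tr.
  apply: (@cvg_taylor_series R D (F x) A (2 * C) A1 (dist G x p)) => //.
  - exact: time_interval_is_interval.
  - by move=> k s; exact: is_derive_on_iter_laplacian.
  - by move=> k s Ds; exact: F_le.
  - by rewrite mulr_ge0 // ltW.
  - move=> A_1; move: tr; rewrite /r A_1 eqxx lte_fin.
    rewrite ltr_pdivlMr ?mulr_gt0 ?expR_gt0 //.
    by congr (_ < _); ring.
have D0 : D 0 by split; rewrite // leeNl oppe0 ltW.
exists r; split.
- rewrite /r; case: ifP => // _.
  by rewrite lte_fin divr_gt0 ?mulr_gt0 ?expR_gt0.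
- move=> x; split.
    move=> k t Dt; apply/cvg_ex; exists (F x k.+1 t).
    apply: is_derive_on_ext Dt _ (is_derive_on_iter_laplacian u_heat Dt).
    by move=> s Ds; exact: deriven_on_heat.
  move=> t0 t Dt0 Dt tr.
  under [X in series X]funext => k do
    rewrite (deriven_on_heat k x T_gt0 u_heat Dt0).
  exact: taylor.
- by move=> A_lt1; rewrite /r lt_eqF.
- by move=> A_1; rewrite /r A_1 eqxx.
(* The coefficients are the iterated Laplacians of u at time 0, so their recurrence holds by
   definition. *)
- exists (fun k x => F x k 0); split=> //.
  + move=> x t rt Dt.
    have := taylor x 0 t D0 Dt; rewrite subr0; apply.
    have [_ t0] := Dt.
    by rewrite ler0_norm // EFinN lteNl.
  + by move=> k x; exact: F_le.
Qed.
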